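(* Let $f\colon\mathbb{R}^J\to\,]-\infty,+\infty]$ be a convex function of Legendre type, let $C$ be a nonempty bounded closed subset of $\operatorname{int}\operatorname{dom}f$, and suppose that $\operatorname{dom}f=\mathbb{R}^J$ and that $C$ is Klee with respect to the right Bregman distance, i.e., for every $y\in\mathbb{R}^J$, $\overrightarrow{Q}^{f}_C(y)$ is a singleton. Then $C$ is a singleton.
   Context: $\mathbb{R}^J$ is the standard Euclidean space. A convex function of Legendre type is a proper, lower semicontinuous, convex function $f$ that is essentially smooth (with $U:=\operatorname{int}\operatorname{dom} f\neq\varnothing$, $f$ is differentiable on $U$ and $\|\nabla f(x_n)\|\to+\infty$ whenever $(x_n)$ is a sequence in $U$ converging to a boundary point of $U$) and essentially strictly convex ($f$ is strictly convex on every convex subset of $\operatorname{dom}\partial f$). No coercivity of $f$ is assumed here. The Bregman distance with respect to $f$ is $D_f(x,y)=f(x)-f(y)-\langle\nabla f(y),x-y\rangle$ if $y\in U$, and $+\infty$ otherwise. The right Bregman farthest-point map is the set-valued map $\overrightarrow{Q}^{f}_C(y)=\operatorname{argmax}_{x\in C}D_f(y,x)$ (the set of maximizers over $x\in C$), $y\in U$. *)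

(* Defs.v *)
From HB Require Import structures.
From mathcomp Require Import all_boot all_order all_algebra.
From mathcomp Require Import all_classical all_reals all_analysis.

Set Implicit Arguments.
Unset Strict Implicit.
Unset Printing Implicit Defensive.

Import Order.TTheory GRing.Theory Num.Theory.
Import numFieldNormedType.Exports.

Local Open Scope classical_set_scope.
Local Open Scope ring_scope.

(* R^J is ['rV[R]_J]. Its library norm is the sup norm, which induces the
   Euclidean topology and the Euclidean bounded sets; the inner product and the
   Euclidean norm are defined explicitly. *)
Definition dot (R : realType) (J : nat) (u v : 'rV[R]_J) : R :=
  \sum_(i < J) u ord0 i * v ord0 i.

Definition enorm (R : realType) (J : nat) (u : 'rV[R]_J) : R :=
  Num.sqrt (dot u u).

Definition singleton (T : Type) (A : set T) : Prop := exists x, A = [set x].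

Section ExtendedRealFunctions.
Variables (R : realType) (J : nat) (f : 'rV[R]_J -> \bar R).

Definition dom : set 'rV[R]_J := [set x | (f x < +oo)%E].

Definition proper_fun : Prop := (forall x, f x != -oo%E) /\ dom !=set0.

Definition convex_efun : Prop := forall (x y : 'rV[R]_J) (t : R),
  0 <= t -> t <= 1 ->
  (f (t *: x + (1 - t) *: y)%R <= t%:E * f x + (1 - t)%:E * f y)%E.

Definition int_dom : set 'rV[R]_J := interior dom.

(* Only meaningful at points of [int_dom], near which [f] is finite. *)
Definition grad (x : 'rV[R]_J) : 'rV[R]_J :=
  \row_(j < J) 'D_(delta_mx ord0 j) (fine \o f) x.

Definition boundary (A : set 'rV[R]_J) : set 'rV[R]_J :=
  closure A `\` interior A.

Definition essentially_smooth : Prop :=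
  [/\ int_dom !=set0,
      forall x, int_dom x -> differentiable (fine \o f) x &
      forall (u : nat -> 'rV[R]_J) (z : 'rV[R]_J),
        (forall n, int_dom (u n)) -> boundary int_dom z ->
        u n @[n --> \oo] --> z ->
        enorm (grad (u n)) @[n --> \oo] --> +oo ].

(* For proper [f] the inequality at a point of [dom] forces [f x < +oo]. *)
Definition subdifferential (x : 'rV[R]_J) : set 'rV[R]_J :=
  [set v | forall y, (f x + (dot v (y - x)%R)%:E <= f y)%E].

Definition dom_subdifferential : set 'rV[R]_J :=
  [set x | subdifferential x !=set0].

Definition strictly_convex_on (S : set 'rV[R]_J) : Prop :=
  forall x y (t : R), S x -> S y -> x <> y -> 0 < t -> t < 1 ->
  (f (t *: x + (1 - t) *: y)%R < t%:E * f x + (1 - t)%:E * f y)%E.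

Definition essentially_strictly_convex : Prop :=
  forall S : set 'rV[R]_J, @convex_set R 'rV[R]_J S ->
  S `<=` dom_subdifferential -> strictly_convex_on S.

Definition legendre : Prop :=
  [/\ proper_fun, lower_semicontinuous f, convex_efun,
      essentially_smooth & essentially_strictly_convex].

Definition bregman (x y : 'rV[R]_J) : \bar R :=
  if y \in int_dom then (f x - f y - (dot (grad y) (x - y)%R)%:E)%E else +oo%E.

(* The maximization is over the second argument of the Bregman distance. *)
Definition right_farthest (C : set 'rV[R]_J) (y : 'rV[R]_J) :
    set 'rV[R]_J :=
  [set x | C x /\ forall z, C z -> (bregman y z <= bregman y x)%E].

Definition right_klee (C : set 'rV[R]_J) : Prop :=
  forall y, singleton (right_farthest C y).

End ExtendedRealFunctions.

(* Main.v *)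
Require Import Defs.
From HB Require Import structures.
From mathcomp Require Import all_boot all_order all_algebra.
From mathcomp Require Import all_classical all_reals all_analysis.
From mathcomp Require Import lra ring.
Import Order.TTheory GRing.Theory Num.Theory.
Import numFieldNormedType.Exports.
Local Open Scope classical_set_scope.
Local Open Scope ring_scope.

(* Let F y be the largest value of D_f(y, x) for x in C, and q y the unique
   point of C where it is attained.  By compactness and uniqueness q is
   continuous.  For fixed x in C, D_f(., x) is convex and vanishes only at x,
   hence is coercive even though f need not be; as F dominates it, F attains its
   minimum at some y.  Moving from y towards q y, i.e. to z = y + t (q y - y)
   with t > 0,
     D_f(z, q z) = F z >= F y >= D_f(y, q z)
   together with convexity gives <grad f z - grad f (q z), q y - y> >= 0.
   Letting t tend to 0, strict monotonicity of grad f forces q y = y.  Then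
   F y = D_f(y, y) = 0, so that D_f(y, x) <= 0 for every x in C, i.e. C = {y}. *)

Set Implicit Arguments.
Unset Strict Implicit.

(** * Continuity of a unique maximizer over a compact set *)

Section ContinuousArgmax.
Variables (T U : topologicalType) (R : realType).

(** Each point of [C] outside a neighbourhood of [q y] is strictly beaten by [q y], and stays beaten
    for nearby parameters. Compactness makes this uniform, so nearby maximizers lie in the
    neighbourhood. *)
Lemma continuous_unique_argmax (D : T -> U -> R) (C : set U) (q : T -> U) :
  compact C -> continuous (fun p : T * U => D p.1 p.2) ->
  (forall y, C (q y)) ->
  (forall y x, C x -> x <> q y -> D y x < D y (q y)) ->
  continuous q.
Proof.
move=> cC cD Cq qmax y A Aqy.
have Aoqy : A° (q y) by exact: nbhs_singleton (nbhs_interior Aqy).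
have cCA : compact (C `&` ~` A°).
  by apply: compact_closedI => //; exact/open_closedC/open_interior.
have lt_near x : (C `&` ~` A°) x ->
    \forall x' \near x & y' \near y, D y' x' < D y' (q y).
  move=> [Cx nAx].
  have xqy : x <> q y by move=> xqy; apply: nAx; rewrite xqy.
  have cDD : D p.2 p.1 - D p.2 (q y) @[p --> (x, y)] --> D y x - D y (q y).
    apply: cvgB.
      apply: (@cvg_comp _ _ _ (fun p : U * T => (p.2, p.1))
        (fun p : T * U => D p.1 p.2)) (cD (y, x)).
      by apply: cvg_pair; [exact: cvg_snd|exact: cvg_fst].
    apply: (@cvg_comp _ _ _ (fun p : U * T => (p.2, q y))
      (fun p : T * U => D p.1 p.2)) (cD (y, q y)).
    by apply: cvg_pair; [exact: cvg_snd|exact: cvg_cst].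
  have : \forall p \near (x, y), D p.2 p.1 - D p.2 (q y) < 0.
    by apply: (cvgr_lt _ cDD); rewrite subr_lt0; exact: qmax.
  by apply: filterS => p; rewrite subr_lt0.
have near_lt := (compact_near_coveringP _).1 cCA _ (nbhs y)
  (fun y' x' => D y' x' < D y' (q y)) (nbhs_filter y) lt_near.
change (\near y, A (q y)); apply: filterS near_lt => y' lty'.
apply: interior_subset.
apply: contrapT => nAq; have /lty' := conj (Cq y') nAq.
apply/negP; rewrite -leNgt.
by have [->//|/(qmax _ _ (Cq y))/ltW] := pselect (q y = q y').
Qed.

End ContinuousArgmax.

Lemma continuous_graph (T U W : topologicalType) (F : T * U -> W) (q : T -> U) :
  continuous q -> continuous F -> continuous (fun t => F (t, q t)).
Proof.
move=> cq cF t; apply: (@cvg_comp _ _ _ (fun t => (t, q t)) F); last exact: cF.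
by apply: cvg_pair; [exact: cvg_id|exact: cq].
Qed.

Lemma continuous_line (R : realType) (V : normedModType R) (v x : V) :
  continuous (fun t : R => t *: v + x).
Proof.
move=> t; apply: cvgD; last exact: cvg_cst.
by apply: cvgZ; [exact: cvg_id|exact: cvg_cst].
Qed.

Lemma continuous_addr (R : realType) (V : normedModType R) (x : V) :
  continuous (fun v => v + x).
Proof. by move=> v; apply: cvgD; [exact: cvg_id|exact: cvg_cst]. Qed.

Lemma closed_sphere (R : realType) (V : normedModType R) (r : R) :
  closed [set v : V | `|v| = r].
Proof.
have /continuous_closedP/(_ _ (@closed_eq _ r)) := @norm_continuous R V.
exact.
Qed.

(** * Differentiable convex functions on a normed space *)

Section DifferentiableConvex.
Variables (R : realType) (V : normedModType R) (g : V -> R).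
Hypothesis diff_g : forall x, differentiable g x.
Implicit Types x y v : V.

Lemma derive_dirZ x v (c : R) : 'D_(c *: v) g x = c * 'D_v g x.
Proof. by rewrite !deriveE // linearZ. Qed.

Lemma derive_dirD x v w : 'D_(v + w) g x = 'D_v g x + 'D_w g x.
Proof. by rewrite !deriveE // linearD. Qed.

Lemma derive_dir0 x : 'D_0 g x = 0.
Proof. by rewrite deriveE // linear0. Qed.

Lemma derive_dirN x v : 'D_(- v) g x = - 'D_v g x.
Proof. by rewrite !deriveE // linearN. Qed.

Hypothesis convex_g : forall x y (t : R), 0 <= t -> t <= 1 ->
  g (t *: x + (1 - t) *: y) <= t * g x + (1 - t) * g y.

(** Convexity bounds the difference quotients with step [0 < h < 1] by [g y - g x]; the bound
    survives the limit from the right. *)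
Lemma convex_derive_le x y : 'D_(y - x) g x <= g y - g x.
Proof.
have /cvg_dnbhs_at_right dg : derivable g x (y - x) by apply: diff_derivable.
apply: cvgr_to_le dg _; near=> h.
have h0 : 0 < h by [].
have h1 : h < 1 by near: h; exact: nbhs_right_lt.
rewrite /= -[_ *: _]/(h^-1 * _) mulrC ler_pdivrMr //.
have -> : h *: (y - x) + x = h *: y + (1 - h) *: x.
  by rewrite scalerBr scalerBl scale1r addrCA addrC.
by have := convex_g y x (ltW h0) (ltW h1); lra.
Unshelve. all: by end_near. Qed.

(* By [convex_derive_le], ['D_v g] is an infimum of difference quotients, which
   are continuous, so it is upper semicontinuous; so is ['D_(- v) g]. *)
Lemma continuous_derive_convex v : continuous ('D_v g).
Proof.
have usc w x (e : R) : 0 < e -> \forall z \near x, 'D_w g z < 'D_w g x + e.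
  move=> e0.
  have /cvg_dnbhs_at_right dg : derivable g x w by apply: diff_derivable.
  have : \forall h \near 0^'+, h^-1 *: (g (h *: w + x) - g x) < 'D_w g x + e.
    by apply: (cvgr_lt _ dg); rewrite -/('D_w g x) ltrDl.
  move=> near_lt.
  have [h [h0 hlt]] : exists h : R, 0 < h /\
      h^-1 * (g (h *: w + x) - g x) < 'D_w g x + e.
    near (0 : R)^'+ => h; exists h; split => //.
    by near: h; exact: near_lt.
  have cg : continuous g by move=> z; exact: differentiable_continuous.
  have cq : h^-1 * (g (h *: w + z) - g z) @[z --> x] -->
      h^-1 * (g (h *: w + x) - g x).
    have cshift : continuous (fun z : V => h *: w + z).
      move=> z; apply: cvgD; [exact: cvg_cst|exact: cvg_id].
    apply: cvgM; first exact: cvg_cst.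
    apply: cvgB; last exact: cg.
    by apply: (@cvg_comp _ _ _ (fun z => h *: w + z) g);
      [exact: cshift|exact: cg].
  near=> z.
  apply: (@le_lt_trans _ _ (h^-1 * (g (h *: w + z) - g z))); last first.
    by near: z; exact: (cvgr_lt _ cq).
  rewrite ler_pdivlMl // -derive_dirZ.
  by have := convex_derive_le z (h *: w + z); rewrite addrK.
move=> x; apply/cvgrPdist_lt => e e0.
near=> z.
have : 'D_v g z < 'D_v g x + e by near: z; exact: usc.
have : 'D_(- v) g z < 'D_(- v) g x + e by near: z; exact: usc.
by rewrite !derive_dirN ltr_norml; lra.
Unshelve. all: by end_near. Qed.

(** A directional derivative replaces the inner product with the gradient, so no coordinates are
    involved; [bregmanE] identifies the two forms. *)
Definition bregman_real y x : R := g y - g x - 'D_(y - x) g x.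

Hypothesis strict_g : forall x y, x <> y ->
  g (2^-1 *: x + (1 - 2^-1) *: y) < 2^-1 * g x + (1 - 2^-1) * g y.

(** The tangent inequality at the midpoint, combined with strict convexity there, is strict. *)
Lemma bregman_real_gt0 x y : x <> y -> 0 < bregman_real y x.
Proof.
move=> /nesym yx; have := strict_g yx.
have := convex_derive_le x (2^-1 *: y + (1 - 2^-1) *: x).
have -> : 2^-1 *: y + (1 - 2^-1) *: x - x = 2^-1 *: (y - x).
  by rewrite scalerBl scale1r scalerBr addrA [in LHS]addrAC addrK.
by rewrite derive_dirZ /bregman_real; lra.
Qed.

End DifferentiableConvex.

(** * Coercivity and the farthest-point argument in finite dimension *)

Section FiniteDimension.
Variables (R : realType) (J : nat) (g : 'rV[R]_J -> R).
Hypothesis diff_g : forall x, differentiable g x.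
Implicit Types x y v : 'rV[R]_J.

Lemma derive_coord x v :
  'D_v g x = \sum_(i < J) v ord0 i * 'D_(delta_mx ord0 i) g x.
Proof.
rewrite deriveE // {1}(row_sum_delta v) linear_sum.
by apply: eq_bigr => i _; rewrite linearZ deriveE.
Qed.

Hypothesis convex_g : forall x y (t : R), 0 <= t -> t <= 1 ->
  g (t *: x + (1 - t) *: y) <= t * g x + (1 - t) * g y.

(** The direction [p.1 - p.2] varies with the point. Expanding it in coordinates leaves derivatives
    in fixed directions only, to which [continuous_derive_convex] applies. *)
Lemma continuous_bregman_real :
  continuous (fun p : 'rV[R]_J * 'rV[R]_J => bregman_real g p.1 p.2).
Proof.
have -> : (fun p => bregman_real g p.1 p.2) = (fun p => g p.1 - g p.2 -
    \sum_(i < J) (p.1 - p.2) ord0 i * 'D_(delta_mx ord0 i) g p.2).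
  by apply/funext => p; rewrite /bregman_real derive_coord.
have cfst : continuous (@fst 'rV[R]_J 'rV[R]_J) by move=> p; exact: cvg_fst.
have csnd : continuous (@snd 'rV[R]_J 'rV[R]_J) by move=> p; exact: cvg_snd.
have cg : continuous g by move=> x; exact: differentiable_continuous.
move=> p; apply: cvgB.
  apply: cvgB.
    by apply: (@cvg_comp _ _ _ fst g); [exact: cfst|exact: cg].
  by apply: (@cvg_comp _ _ _ snd g); [exact: csnd|exact: cg].
apply: cvg_big => [|i _]; first exact: add_continuous.
apply: cvgM; last first.
  apply: (@cvg_comp _ _ _ snd ('D_(delta_mx ord0 i) g)); first exact: csnd.
  exact: (continuous_derive_convex diff_g convex_g).
apply: (@cvg_comp _ _ _ (fun p : 'rV[R]_J * 'rV[R]_J => p.1 - p.2)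
  (fun v => v ord0 i)); last exact: coord_continuous.
by apply: cvgB; [exact: cfst|exact: csnd].
Qed.


Hypothesis strict_g : forall x y, x <> y ->
  g (2^-1 *: x + (1 - 2^-1) *: y) < 2^-1 * g x + (1 - 2^-1) * g y.

(* [bregman_real g y x >= m * `|y - x|] outside the unit ball around [x], where
   [m] is the minimum on the unit sphere. *)
Lemma bregman_real_coercive x (M : R) :
  exists2 r, 0 < r & forall y, r < `|y - x| -> M < bregman_real g y x.
Proof.
pose S : set 'rV[R]_J := [set v | `|v| = 1].
pose D v := bregman_real g (v + x) x.
have cS : compact S.
  apply: bounded_closed_compact.
    by exists 1; split => // e e1 v /= ->; exact: ltW.
  exact: closed_sphere.
have cD : continuous D.
  move=> v; have cx : continuous (fun y => bregman_real g y x).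
    apply: continuous_graph continuous_bregman_real; exact: cst_continuous.
  apply: (@cvg_comp _ _ _ (fun v => v + x) (fun y => bregman_real g y x));
    [exact: continuous_addr|exact: cx].
have [m m0 Dm] : exists2 m, 0 < m & forall v, S v -> m <= D v.
  (* For [J = 0] the sphere is empty and any positive [m] will do. *)
  have [S0|S0] := pselect (S !=set0); last first.
    by exists 1 => // v Sv; case: S0; exists v.
  have [v] := compact_EVT_min S0 cS (continuous_subspaceT cD).
  rewrite inE => Sv Dv; exists (D v).
    apply: (bregman_real_gt0 diff_g convex_g strict_g) => xv.
    have v0 : v = 0 by apply: (@addIr _ x); rewrite add0r.
    by move: Sv; rewrite /S /= v0 normr0 => /esym/eqP; rewrite oner_eq0.
  by move=> w Sw; apply: Dv; rewrite inE.
(* The summand [1] puts [y] outside the unit ball, so that [r^-1] is a convexity weight; the other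
   one gives [M < m * r]. *)
exists (1 + `|M| / m) => [|y rho]; first by rewrite ltr_wpDr// divr_ge0// ltW.
set r := `|y - x| in rho.
have Mm0 : 0 <= `|M| / m by rewrite divr_ge0// ltW.
have r1 : 1 < r by lra.
have r0 : 0 < r by lra.
have Sv : S (r^-1 *: (y - x)).
  by rewrite /S /= normrZ ger0_norm ?invr_ge0 ?ltW// mulVf ?gt_eqF.
(* Convexity in the first argument, between [y] and [x], where the distance is zero. *)
have Dle : D (r^-1 *: (y - x)) <= r^-1 * bregman_real g y x.
  rewrite /D /bregman_real addrK (derive_dirZ diff_g).
  have := convex_g y x (t := r^-1); rewrite invr_ge0 ltW// invf_le1// ltW//.
  have -> : r^-1 *: y + (1 - r^-1) *: x = r^-1 *: (y - x) + x.
    by apply/rowP => i; rewrite !mxE; ring.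
  by move=> /(_ erefl erefl); lra.
have : m <= r^-1 * bregman_real g y x by apply: le_trans (Dm _ Sv) Dle.
rewrite ler_pdivlMl//; apply: lt_le_trans.
apply: le_lt_trans (ler_norm M) _.
by rewrite -ltr_pdivrMr//; lra.
Qed.

Lemma unique_farthest_point_singleton (C : set 'rV[R]_J) :
  compact C ->
  (forall y, exists x, C x /\
     forall z, C z -> z <> x -> bregman_real g y z < bregman_real g y x) ->
  singleton C.
Proof.
move=> cC /choice[q qP].
have Cq y : C (q y) by have [] := qP y.
have qmax y x : C x -> bregman_real g y x <= bregman_real g y (q y).
  by have [->//|xq Cx] := pselect (x = q y); exact/ltW/(qP y).2.
have cq : continuous q.
  apply: (continuous_unique_argmax cC continuous_bregman_real Cq) => y x Cx.
  exact: (qP y).2.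
pose F y := bregman_real g y (q y).
have cF : continuous F by apply: continuous_graph continuous_bregman_real.
have [x0 Cx0] : exists x, C x by exists (q 0).
have [r r0 coer] := bregman_real_coercive x0 (F x0).
(* Outside the closed ball of radius [r] around [x0], [F] exceeds [F x0], so a minimum over the ball
   is global. *)
have [y Fy] : exists y, forall z, F y <= F z.
  pose B : set 'rV[R]_J := closed_ball_ Num.norm x0 r.
  have cB : compact B.
    apply: bounded_closed_compact; last exact: closed_closed_ball_.
    exists (r + `|x0|); split => [|e re z]; first exact: num_real.
    rewrite /B /closed_ball_ /= => zr.
    rewrite -[z](subrK x0); apply: le_trans (ler_normD _ _) _.
    by move: zr; rewrite distrC; lra.
  have Bx0 : B x0 by rewrite /B /closed_ball_ /= subrr normr0 ltW.
  have [y] := compact_EVT_min (ex_intro _ x0 Bx0) cB (continuous_subspaceT cF).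
  move=> _ Fy; exists y => z.
  have [zr|zr] := leP `|z - x0| r.
    by apply/Fy/mem_set; rewrite /B /closed_ball_ /= distrC.
  apply: (@le_trans _ _ (F x0)); first exact/Fy/mem_set.
  by apply: le_trans (qmax z x0 Cx0); exact/ltW/coer.
have qy : q y = y.
  apply: contrapT => qy; set d := q y - y.
  (* The difference of the two sides is the sum of the Bregman distances between [y] and [q y] in
     both orders. *)
  have mono : 'D_d g y < 'D_d g (q y).
    have := bregman_real_gt0 diff_g convex_g strict_g qy.
    have := bregman_real_gt0 diff_g convex_g strict_g (nesym qy).
    rewrite /bregman_real -/d -(opprB (q y) y) -/d (derive_dirN diff_g); lra.
  pose h t := 'D_d g (q (t *: d + y)) - 'D_d g (t *: d + y).
  have cline : continuous (fun t : R => t *: d + y) by exact: continuous_line.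
  have cD : continuous ('D_d g) by exact: continuous_derive_convex.
  have ch : h t @[t --> 0^'+] --> h 0.
    apply: cvg_at_right_filter; apply: cvgB.
      apply: (@cvg_comp _ _ _ (fun t => q (t *: d + y)) ('D_d g));
        last exact: cD.
      by apply: (@cvg_comp _ _ _ (fun t => t *: d + y) q);
        [exact: cline|exact: cq].
    by apply: (@cvg_comp _ _ _ (fun t => t *: d + y) ('D_d g));
      [exact: cline|exact: cD].
  have h0 : 0 < h 0 by rewrite /h scale0r add0r subr_gt0.
  have near_h : \forall t \near 0^'+, 0 < h t by exact: (cvgr_gt _ ch).
  have [t t0] : exists2 t : R, 0 < t & 0 < h t.
    by near (0 : R)^'+ => t; exists t => //; near: t.
  apply/negP; rewrite -leNgt /h; set z := t *: d + y; set x := q z.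
  (* This bounds [g z - g y] below by [t * 'D_d g x]; the tangent inequality at [z] bounds it above
     by [t * 'D_d g z]. Hence [h t <= 0]. *)
  have := le_trans (qmax y x (Cq z)) (Fy z).
  have := convex_derive_le diff_g convex_g z y.
  have -> : y - z = - (t *: d) by rewrite opprD addrCA subrr addr0.
  rewrite /F /bregman_real -/x -[z - x]addrA.
  rewrite (derive_dirN diff_g z) (derive_dirD diff_g x (t *: d)).
  rewrite !(derive_dirZ diff_g) => le1 le2.
  rewrite -(pmulr_rle0 _ t0) mulrBr; lra.
exists y; apply/seteqP; split => [x Cx|_ -> /=]; last by rewrite -qy.
apply: contrapT => /= xy.
have := qmax y x Cx; rewrite qy leNgt => /negP; apply.
rewrite {1}/bregman_real !subrr (derive_dir0 diff_g) subr0.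
exact: (bregman_real_gt0 diff_g convex_g strict_g).
Unshelve. all: by end_near. Qed.

End FiniteDimension.

(** * From an everywhere finite Legendre function to a real-valued one *)

Section EverywhereFiniteLegendre.
Variables (R : realType) (J : nat) (f : 'rV[R]_J -> \bar R).
Hypotheses (legendre_f : legendre f) (domT : dom f = [set: 'rV[R]_J]).
Implicit Types x y : 'rV[R]_J.

Lemma int_domT : int_dom f = setT.
Proof. by rewrite /int_dom domT interiorT. Qed.

Lemma fine_legendreK x : (fine (f x))%:E = f x.
Proof.
have [[ninfty _] _ _ _ _] := legendre_f.
rewrite fineK// fin_numE ninfty /= lt_eqF//.
by have : dom f x by rewrite domT.
Qed.

Lemma differentiable_legendre x : differentiable (fine \o f) x.
Proof. by have [_ _ _ [_ + _] _] := legendre_f; apply; rewrite int_domT. Qed.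

Lemma dot_grad x v : dot (grad f x) v = 'D_v (fine \o f) x.
Proof.
rewrite (derive_coord differentiable_legendre).
by apply: eq_bigr => i _; rewrite mxE mulrC.
Qed.

Lemma bregmanE y x : bregman f y x = (bregman_real (fine \o f) y x)%:E.
Proof.
rewrite /bregman int_domT in_setT dot_grad -[f y]fine_legendreK.
by rewrite -[f x]fine_legendreK.
Qed.

Lemma convex_legendre x y (t : R) : 0 <= t -> t <= 1 ->
  fine (f (t *: x + (1 - t) *: y)) <= t * fine (f x) + (1 - t) * fine (f y).
Proof.
have [_ _ cvx _ _] := legendre_f; move=> t0 t1.
have := cvx x y t t0 t1.
rewrite -[f x]fine_legendreK -[f y]fine_legendreK -[f (_ + _)]fine_legendreK.
by rewrite -!EFinM -EFinD lee_fin.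
Qed.

(** The gradient is a subgradient at every point; thus essential strict convexity can be applied on
    the whole space. *)
Lemma dom_subdifferentialT : dom_subdifferential f = setT.
Proof.
apply/seteqP; split => // x _; exists (grad f x) => y.
rewrite -[f x]fine_legendreK -[f y]fine_legendreK -EFinD lee_fin dot_grad.
rewrite -lerBrDl.
exact: (convex_derive_le differentiable_legendre convex_legendre).
Qed.

Lemma strictly_convex_legendre x y : x <> y ->
  fine (f (2^-1 *: x + (1 - 2^-1) *: y)) <
    2^-1 * fine (f x) + (1 - 2^-1) * fine (f y).
Proof.
have [_ _ _ _ strict] := legendre_f; move=> xy.
have cvxT : @convex_set R 'rV[R]_J setT by [].
have := strict setT cvxT _ x y 2^-1 I I xy.
rewrite dom_subdifferentialT => /(_ (@subset_refl _ _)).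
rewrite -[f x]fine_legendreK -[f y]fine_legendreK -[f (_ + _)]fine_legendreK.
by rewrite -!EFinM -EFinD lte_fin; apply; lra.
Qed.

End EverywhereFiniteLegendre.

Unset Implicit Arguments.

Theorem theorem7p2 (R : realType) (J : nat) (f : 'rV[R]_J -> \bar R)
    (C : set 'rV[R]_J) :
  legendre f ->
  C !=set0 -> bounded_set C -> closed C -> C `<=` int_dom f ->
  dom f = [set: 'rV[R]_J] ->
  right_klee f C ->
  singleton C.
Proof.
move=> legf _ bC cC _ domT klee.
apply: (@unique_farthest_point_singleton R J (fine \o f)).
- exact: differentiable_legendre.
- exact: convex_legendre.
- exact: strictly_convex_legendre.
- exact: bounded_closed_compact.
move=> y; have [x far_x] := klee y.
have [Cx max_x] : right_farthest f C y x by rewrite far_x.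
(* A point [z] of [C] doing at least as well as [x] would be a second maximizer. *)
exists x; split => // z Cz zx; rewrite ltNge; apply/negP => xz.
apply: zx; suff : right_farthest f C y z by rewrite far_x.
split => // w /max_x /le_trans; apply.
by rewrite !bregmanE// lee_fin.
Qed.
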